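(* Let $J$ be a finite nonempty set and let $\mathscr{S}$ be a nonempty family of subsets of $J$ that is irredundant and covers $J$. Let $H^c_{\mathscr{S}}=(J,\mathcal{E}_{\mathscr{S}})$ be the conflict hypergraph of $\mathscr{S}$, with rank $r(H^c_{\mathscr{S}})$, and let $k\ge 1$ be an integer. Then a $k$-way independent branching scheme exists for $\operatorname{CDC}(\mathscr{S})$ if and only if $r(H^c_{\mathscr{S}})\le k$. In particular, if $\mathcal{E}_{\mathscr{S}}=\{E^j=\{e^j_1,\ldots,e^j_{|E^j|}\}\}_{j=1}^t$, then an $r(H^c_{\mathscr{S}})$-way independent branching scheme for $\operatorname{CDC}(\mathscr{S})$ is given by $$L^j_i=\begin{cases} J\setminus\{e^j_i\} & i\le |E^j|,\\ \emptyset & \text{otherwise,}\end{cases}\qquad i\in\{1,\ldots,r(H^c_{\mathscr{S}})\},\ j\in\{1,\ldots,t\}.$$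
   Context: $\Delta^J=\{\lambda\in\mathbb{R}^J_{\ge 0}:\sum_{v\in J}\lambda_v=1\}$. For $S\subseteq J$, $Q(S)=\{\lambda\in\Delta^J:\lambda_v\le 0\ \forall v\in J\setminus S\}$, and $\operatorname{CDC}(\mathscr{S})=\bigcup_{S\in\mathscr{S}}Q(S)$. $\mathscr{S}$ is irredundant if there are no distinct $S,T\in\mathscr{S}$ with $S\subseteq T$; it covers $J$ if $\bigcup_{S\in\mathscr{S}}S=J$. A set $T\subseteq J$ is feasible if $T\subseteq S$ for some $S\in\mathscr{S}$, and infeasible otherwise. The conflict hypergraph is $H^c_{\mathscr{S}}=(J,\mathcal{E}_{\mathscr{S}})$, where $\mathcal{E}_{\mathscr{S}}$ is the set of all (inclusionwise) minimal infeasible subsets of $J$. The rank of a hypergraph $(J,\mathcal{E})$ is $\max\{|E|:E\in\mathcal{E}\}$ (taken to be $0$ if $\mathcal{E}=\emptyset$). A $k$-way independent branching (IB) scheme for $\operatorname{CDC}(\mathscr{S})$ is a family $(L^j_1,\ldots,L^j_k)$, $j\in\{1,\ldots,t\}$, with each $L^j_i\subseteq J$, such that $\operatorname{CDC}(\mathscr{S})=\bigcap_{j=1}^t\bigcup_{i=1}^k Q(L^j_i)$ (an intersection over no levels is read as $\Delta^J$). Equivalently: $T\subseteq J$ is feasible if and only if for every $j$ there is $i$ with $T\subseteq L^j_i$. *)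

(* Defs.v *)
From HB Require Import structures.
From mathcomp Require Import all_boot all_order all_algebra.
From mathcomp Require Import classical_sets reals.

Set Implicit Arguments.
Unset Strict Implicit.
Unset Printing Implicit Defensive.

Import Order.TTheory GRing.Theory Num.Theory.

Local Open Scope classical_set_scope.
Local Open Scope ring_scope.

(* The ground set J is a finType and vectors of R^J are finite functions.
   Subsets of J and families of them are finite sets ({set J}, {set {set J}});
   subsets of R^J are classical sets (set {ffun J -> R}). *)

Section Combinatorics.
Variable J : finType.
Implicit Types (F : {set {set J}}) (S T : {set J}).

Definition irredundant F : Prop :=
  forall S T, S \in F -> T \in F -> S != T -> ~~ (S \subset T).

Definition covers F : Prop := finset.cover F = [set: J]%SET.

Definition feasible F T : bool := [exists S in F, T \subset S].

Definition infeasible F T : bool := ~~ feasible F T.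

(* A hypergraph on the vertex set J is given by its set of edges. *)
Definition conflict_hypergraph F : {set {set J}} :=
  [set E : {set J} | minset (infeasible F) E]%SET.

(* The maximum over the empty family is 0. *)
Definition hypergraph_rank (H : {set {set J}}) : nat := (\max_(E in H) #|E|)%N.

End Combinatorics.

Section Polyhedra.
Variables (R : realType) (J : finType).

Definition simplex : set {ffun J -> R} :=
  [set x | (forall v, 0 <= x v) /\ \sum_v x v = 1].

Definition face (S : {set J}) : set {ffun J -> R} :=
  [set x | simplex x /\ forall v, v \notin S -> x v <= 0].

Definition CDC (F : {set {set J}}) : set {ffun J -> R} :=
  \bigcup_(S in [set` F]) face S.

(* Levels j and alternatives i are numbered from 0.  The intersection is taken
   inside the simplex, which matters only when there are no levels (t = 0). *)
Definition is_IB_scheme (F : {set {set J}}) (k t : nat)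
    (L : 'I_t -> 'I_k -> {set J}) : Prop :=
  CDC F = simplex `&` \bigcap_(j in [set: 'I_t]) \bigcup_(i in [set: 'I_k]) face (L j i).

Definition has_IB_scheme (F : {set {set J}}) (k : nat) : Prop :=
  exists (t : nat) (L : 'I_t -> 'I_k -> {set J}), is_IB_scheme F L.

End Polyhedra.

(* E j is the j-th edge and e j i its i-th element, for i < #|E j|; the values
   e j i with i >= #|E j| are not used. *)
Definition edge_scheme (J : finType) (r t : nat) (E : 'I_t -> {set J})
    (e : 'I_t -> nat -> J) (j : 'I_t) (i : 'I_r) : {set J} :=
  if (i < #|E j|)%N then ([set: J] :\ e j i)%SET else finset.set0.

(* Main.v *)
Require Import Defs.
From HB Require Import structures.
From mathcomp Require Import all_boot all_order all_algebra.
From mathcomp Require Import classical_sets reals.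

(** A point of the simplex lies in the face of S exactly when its support is
    contained in S, and every nonempty T is the support of its barycenter, so a
    branching scheme is the same thing as a combinatorial description of the
    nonempty feasible sets.  If a minimal infeasible E is cut off at level j,
    choosing one element of E outside each of the k alternatives of level j
    gives an infeasible subset of E, which by minimality is E: hence #|E| <= k.
    Conversely, T is feasible iff it misses an element of every conflict. *)

Set Implicit Arguments.
Unset Strict Implicit.

Import Order.TTheory GRing.Theory Num.Theory.
Local Open Scope ring_scope.

Section FeasibleSets.
Variables (J : finType) (F : {set {set J}}).
Implicit Types S T E : {set J}.

Lemma feasibleS S T : S \subset T -> feasible F T -> feasible F S.
Proof.
move=> sST /existsP[U /andP[UF sTU]]; apply/existsP; exists U.
by rewrite UF (fintype.subset_trans sST sTU).
Qed.

Lemma feasible0 : F != finset.set0 -> feasible F finset.set0.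
Proof.
by case/set0Pn=> S SF; apply/existsP; exists S; rewrite SF finset.sub0set.
Qed.

(** [J] is finite, so an infeasible set can be shrunk to a minimal one; conversely infeasibility
    passes to supersets by [feasibleS]. *)
Lemma infeasible_conflict T :
  infeasible F T <-> exists2 E, E \in conflict_hypergraph F & E \subset T.
Proof.
split=> [/minset_exists[E minE sET]|[E]]; first by exists E; rewrite ?inE.
rewrite inE => /minsetp infE sET.
by apply: contra infE; apply: feasibleS.
Qed.

End FeasibleSets.

Section Support.
Variables (R : realType) (J : finType).
Implicit Types (x : {ffun J -> R}) (F : {set {set J}}) (S T : {set J}).

Definition support_set x : {set J} := [set v | x v != 0]%SET.

(** On the simplex coordinates are nonnegative, so [x v <= 0] forces [x v = 0]. *)
Lemma faceE S x : face S x <-> simplex x /\ support_set x \subset S.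
Proof.
split=> -[Dx sub]; split=> //.
  apply/fintype.subsetP=> v; rewrite inE; apply: contraR => /sub xv.
  by rewrite eq_le xv Dx.1.
move=> v vS; rewrite le_eqVlt; apply/orP; left.
by apply: contraR vS => xv; apply: (fintype.subsetP sub); rewrite inE.
Qed.

Lemma support_set_neq0 x : simplex x -> support_set x != finset.set0.
Proof.
case=> _ sum_x; apply/negP => /eqP supp0.
have /eqP := oner_neq0 R; apply; rewrite -sum_x big1 // => v _.
by move/finset.setP/(_ v): supp0; rewrite !inE => /negbFE/eqP.
Qed.

Lemma exists_support T :
  T != finset.set0 -> exists2 x, simplex x & support_set x = T.
Proof.
rewrite -card_gt0 => T_gt0.
have nzT : #|T|%:R != 0 :> R by rewrite pnatr_eq0 -lt0n.
exists [ffun v => if v \in T then #|T|%:R^-1 else 0].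
  split=> [v|]; first by rewrite ffunE; case: ifP; rewrite ?invr_ge0.
  under eq_bigr do rewrite ffunE.
  by rewrite -big_mkcond sumr_const -[LHS]mulr_natl divff.
apply/finset.setP=> v; rewrite inE ffunE; case: ifP => _; last by rewrite eqxx.
by rewrite invr_eq0.
Qed.

Lemma CDC_E F x : CDC F x <-> simplex x /\ feasible F (support_set x).
Proof.
split=> [[S SF /faceE[Dx sub]]|[Dx /existsP[S /andP[SF sub]]]].
  by split=> //; apply/existsP; exists S; apply/andP; split.
by exists S => //; apply/faceE.
Qed.

(** Only nonempty [T] occur because coordinates summing to 1 cannot all vanish: no point of the
    simplex tests the empty set. *)
Lemma IB_schemeP F k t (L : 'I_t -> 'I_k -> {set J}) :
  is_IB_scheme R F L <->
  forall T, T != finset.set0 ->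
    feasible F T <-> forall j, exists i, T \subset L j i.
Proof.
split=> [schemeL T T0|schemeL].
  have [x Dx <-] := exists_support T0.
  have := congr1 (@^~ x) schemeL => /= CDCx; split=> [fx j|subL].
    have : CDC F x by apply/CDC_E.
    rewrite CDCx => -[_ /(_ j I) [i _ /faceE[_ sub]]].
    by exists i.
  suff /CDC_E[] : CDC F x by [].
  rewrite CDCx; split=> // j _; have [i sub] := subL j.
  by exists i => //; apply/faceE.
apply/seteqP; split=> x.
  move=> /CDC_E[Dx /(schemeL _ (support_set_neq0 Dx)) subL].
  split=> // j _; have [i sub] := subL j.
  by exists i => //; apply/faceE.
case=> Dx subL; apply/CDC_E; split=> //.
apply/(schemeL _ (support_set_neq0 Dx)) => j.
by have [i _ /faceE[_ sub]] := subL j I; exists i.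
Qed.

Lemma IB_scheme_rank F k :
  F != finset.set0 -> (1 <= k)%N -> has_IB_scheme R F k ->
  (hypergraph_rank (conflict_hypergraph F) <= k)%N.
Proof.
move=> F0 k_gt0 [t [L /IB_schemeP schemeL]].
apply/bigmax_leqP => E; rewrite inE => /minsetP[infE minE].
(* [schemeL] speaks only of nonempty sets, so it can be applied to [E] only after this. *)
have E0 : E != finset.set0.
  by apply: contraNneq infE => ->; apply: feasible0.
have [j cutE] : exists j, forall i, ~~ (E \subset L j i).
  have [/forallP subL|] := boolP [forall j, [exists i, E \subset L j i]].
    case/negP: infE; apply/(schemeL _ E0) => j; exact/existsP.
  rewrite negb_forall => /existsP[j]; rewrite negb_exists => /forallP cutE.
  by exists j.
have w_ex i : exists v, (v \in E) && (v \notin L j i).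
  by have /fintype.subsetPn[v vE vL] := cutE i; exists v; apply/andP.
pose w i := xchoose (w_ex i).
have wP i : (w i \in E) && (w i \notin L j i) := xchooseP (w_ex i).
pose T := [set w i | i : 'I_k]%SET.
(* Here [1 <= k] enters: without an alternative, [T] would be empty. *)
have T0 : T != finset.set0.
  by apply/set0Pn; exists (w (Ordinal k_gt0)); apply: imset_f.
(* If [T] fitted into alternative [i] of level [j], so would its element [w i], which was chosen
   outside it. *)
have infT : infeasible F T.
  apply/negP => /(schemeL _ T0)/(_ j)[i /fintype.subsetP sub].
  have /andP[_ /negP] := wP i; apply; apply: sub; exact: imset_f.
have sTE : T \subset E.
  by apply/fintype.subsetP=> _ /imsetP[i _ ->]; case/andP: (wP i).
(* Minimality gives [T = E], and [T] is the image of a set of [k] indices. *)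
rewrite -(minE T infT sTE) -[leqRHS]card_ord; exact: leq_imset_card.
Qed.

(** A nonempty [T] fits into an alternative of level [j] iff it misses some element of [E j], so
    level [j] rejects exactly the sets containing the conflict [E j]. Allowing any [k] above the
    rank serves both the existence claim and the explicit scheme. *)
Lemma edge_scheme_IB F k t (E : 'I_t -> {set J}) (e : 'I_t -> nat -> J) :
  (hypergraph_rank (conflict_hypergraph F) <= k)%N ->
  [set E j | j : 'I_t]%SET = conflict_hypergraph F ->
  (forall j : 'I_t, E j = [set e j i | i : 'I_#|E j|]%SET) ->
  is_IB_scheme R F (@edge_scheme J k t E e).
Proof.
move=> /bigmax_leqP le_k imE Ee; apply/IB_schemeP => T T0.
have EH j : E j \in conflict_hypergraph F by rewrite -imE imset_f.
split=> [fT j|subL].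
  have /fintype.subsetPn[v] : ~~ (E j \subset T).
    apply: contraL fT => sET.
    by apply/infeasible_conflict; exists (E j).
  rewrite {1}(Ee j) => /imsetP[i _ ->] eiT.
  (* The rank bound ensures that level [j] has an alternative for each element of [E j]. *)
  exists (widen_ord (le_k _ (EH j)) i).
  by rewrite /edge_scheme /= ltn_ord subsetD1 finset.subsetT.
apply: contraT => /infeasible_conflict[C].
rewrite -imE => /imsetP[j _ ->] sET; have [i] := subL j.
rewrite /edge_scheme; case: ifP => [lt_i|_]; last first.
  (* The padding alternatives are empty and hold no nonempty [T]. *)
  by rewrite finset.subset0 (negPf T0).
rewrite subsetD1 => /andP[_ /negP[]]; apply: (fintype.subsetP sET).
by rewrite (Ee j); apply/imsetP; exists (Ordinal lt_i).
Qed.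

End Support.

Lemma exists_edge_enumeration (J : finType) (H : {set {set J}}) :
  (0 < #|J|)%N ->
  exists t (E : 'I_t -> {set J}) (e : 'I_t -> nat -> J),
    [set E j | j : 'I_t]%SET = H /\
    forall j : 'I_t, E j = [set e j i | i : 'I_#|E j|]%SET.
Proof.
(* [v0] is the default for the values of [e] past the end of an edge. *)
case/card_gt0P=> v0 _; pose E (j : 'I_#|H|) : {set J} := enum_val j.
exists #|H|, E, (fun j => nth v0 (enum (E j))); split=> [|j].
  apply/finset.setP=> C; apply/imsetP/idP => [[j _ ->]|CH].
    exact: enum_valP.
  by exists (enum_rank_in CH C); rewrite /E ?enum_rankK_in.
apply/finset.setP=> v; apply/idP/imsetP => [vE|[i _ ->]].
  exists (enum_rank_in vE v) => //.
  by rewrite -enum_val_nth enum_rankK_in.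
by rewrite -enum_val_nth enum_valP.
Qed.

Theorem theorem1 (R : realType) (J : finType) (F : {set {set J}})
    (J_nonempty : (0 < #|J|)%N) (F_nonempty : F != finset.set0)
    (F_irredundant : irredundant F) (F_covers : covers F) :
  (forall k : nat, (1 <= k)%N ->
     has_IB_scheme R F k <->
     (hypergraph_rank (conflict_hypergraph F) <= k)%N)
  /\
  (forall (t : nat) (E : 'I_t -> {set J}) (e : 'I_t -> nat -> J),
     [set E j | j : 'I_t]%SET = conflict_hypergraph F ->
     (forall j : 'I_t, E j = [set e j i | i : 'I_#|E j|]%SET) ->
     is_IB_scheme R F
       (@edge_scheme J (hypergraph_rank (conflict_hypergraph F)) t E e)).
Proof.
(* The explicit scheme is the case where [k] equals the rank. *)
split=> [k k_gt0|t E e]; last exact: edge_scheme_IB.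
split=> [|le_k]; first exact: IB_scheme_rank.
have [t [E [e [imE Ee]]]] :=
  exists_edge_enumeration (conflict_hypergraph F) J_nonempty.
exists t, (edge_scheme E e); exact: edge_scheme_IB.
Qed.
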